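(* Let $\mathsf{C}$ be an a.s.-compatibly representable Markov category with conditionals. Consider two morphisms $f\colon\Theta\to X$ and $g\colon\Theta\to Y$ in $\mathsf{C}$, with associated morphisms $\hat f_{\mathrm{prsamp}},\hat g_{\mathrm{prsamp}}\colon P\Theta\to P\Theta$ (the standard measures parametrized by the prior). Then the following are equivalent: 1. $f$ is more informative than $g$ in the Bayesian sense, i.e. there exists a morphism $c\colon X\otimes P\Theta\to Y$ satisfying $$(\mathrm{id}_\Theta\otimes c)\circ(\mathrm{id}_\Theta\otimes f\otimes\mathrm{id}_{P\Theta})\circ(\mathrm{copy}_\Theta\otimes\mathrm{id}_{P\Theta})\circ(\mathrm{samp}_\Theta\otimes\mathrm{id}_{P\Theta})\circ\mathrm{copy}_{P\Theta}=(\mathrm{id}_\Theta\otimes g)\circ\mathrm{copy}_\Theta\circ\mathrm{samp}_\Theta.$$ 2. There exists a $\hat g_{\mathrm{prsamp}}$-dilation $t\colon P\Theta\otimes P\Theta\to P\Theta$ satisfying $$t\circ(\mathrm{id}_{P\Theta}\otimes\hat g_{\mathrm{prsamp}})\circ\mathrm{copy}_{P\Theta}=\hat f_{\mathrm{prsamp}}.$$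
   Context: Coherence isomorphisms of monoidal categories are suppressed. A Markov category is a symmetric monoidal category $(\mathsf{C},\otimes,I)$ whose unit $I$ is terminal (write $\mathrm{del}_X \colon X \to I$), in which every object $X$ carries a distinguished morphism $\mathrm{copy}_X \colon X \to X\otimes X$ making $(X,\mathrm{copy}_X,\mathrm{del}_X)$ a commutative comonoid, and such that $\mathrm{copy}_{X\otimes Y} = (\mathrm{id}_X\otimes \mathrm{swap}_{X,Y}\otimes \mathrm{id}_Y)\circ(\mathrm{copy}_X\otimes \mathrm{copy}_Y)$. A morphism $f\colon X\to Y$ is deterministic if $\mathrm{copy}_Y\circ f=(f\otimes f)\circ \mathrm{copy}_X$; deterministic morphisms form a subcategory $\mathsf{C}_{\det}$. Conditionals: a conditional of $f\colon A\to X\otimes Y$ with respect to $X$ is a morphism $f_{|X}\colon X\otimes A\to Y$ with $f=(\mathrm{id}_X\otimes f_{|X})\circ(\mathrm{copy}_X\otimes \mathrm{id}_A)\circ(((\mathrm{id}_X\otimes \mathrm{del}_Y)\circ f)\otimes \mathrm{id}_A)\circ \mathrm{copy}_A$; conditionals with respect to the other tensor factor are defined analogously, using the symmetry. $\mathsf{C}$ has conditionals if these exist for all such $f$. Almost sure equality: for $h\colon A\to X$ and $f,g\colon X\to Y$, write $f=_{h\text{-a.s.}}g$ if $(\mathrm{id}_X\otimes f)\circ \mathrm{copy}_X\circ h=(\mathrm{id}_X\otimes g)\circ \mathrm{copy}_X\circ h$. Representability: $\mathsf{C}$ is representable if every object $X$ has a distribution object, i.e. an object $PX$ with a morphism $\mathrm{samp}_X\colon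 PX\to X$ such that $\mathrm{samp}_X\circ -\colon \mathsf{C}_{\det}(A,PX)\to\mathsf{C}(A,X)$ is a bijection for all $A$. Its inverse is written $f\mapsto f^\sharp$. $P$ is a functor $\mathsf{C}\to\mathsf{C}_{\det}$, where for $f\colon X\to Y$, $Pf=(f\circ\mathrm{samp}_X)^\sharp$. $\mathsf{C}$ is a.s.-compatibly representable if it is representable and for all $p\colon B\to A$ and $f,g\colon A\to X$: $f^\sharp=_{p\text{-a.s.}}g^\sharp$ if and only if $f=_{p\text{-a.s.}}g$. Parametrized standard measure: for $f\colon\Theta\to X$ let $\mathfrak f:=(\mathrm{id}_\Theta\otimes f)\circ\mathrm{copy}_\Theta\circ\mathrm{samp}_\Theta\colon P\Theta\to\Theta\otimes X$, let $\mathfrak f_{|X}\colon X\otimes P\Theta\to\Theta$ be a conditional of $\mathfrak f$ with respect to $X$, and set $$\hat f_{\mathrm{prsamp}}:=(\mathfrak f_{|X})^\sharp\circ((f\circ\mathrm{samp}_\Theta)\otimes\mathrm{id}_{P\Theta})\circ\mathrm{copy}_{P\Theta}\colon P\Theta\to P\Theta$$ (independent of the choice of conditional); similarly for $g$. Dilation: for $q\colon B\to P\Theta$, a morphism $t\colon B\otimes P\Theta\to P\Theta$ is a $q$-dilation (with respect to the free $P$-algebra structure $P(\mathrm{samp}_\Theta)\colon PP\Theta\to P\Theta$) if $$(\mathrm{id}_{P\Theta}\otimes(P(\mathrm{samp}_\Theta)\circ t^\sharp))\circ(\mathrm{swap}_{B,P\Theta}\otimes\mathrm{id}_{P\Theta})\circ(\mathrm{id}_B\otimes\mathrm{copy}_{P\Theta})\circ(\mathrm{id}_B\otimes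 q)\circ\mathrm{copy}_B=\mathrm{copy}_{P\Theta}\circ q.$$ Here it is used with $B=P\Theta$ and $q=\hat g_{\mathrm{prsamp}}$; the first tensor factor of the domain of $t$ is the prior. *)

(* Defs.v *)
From HB Require Import structures.
From mathcomp Require Import ssreflect ssrfun.

Set Implicit Arguments.
Unset Strict Implicit.
Unset Printing Implicit Defensive.

Declare Scope cat_scope.
Delimit Scope cat_scope with cat.
Local Open Scope cat_scope.

(* A category is presented by its type of objects [C]; the type of morphisms  *)
(* and the further structure are attached to [C].  Equality of morphisms is   *)
(* Leibniz equality.                                                          *)
HB.mixin Record isCategory (C : Type) := {
  hom : C -> C -> Type;
  idm : forall X, hom X X;
  comp : forall {X Y Z}, hom Y Z -> hom X Y -> hom X Z;
  comp_idl : forall X Y (f : hom X Y), comp (idm Y) f = f;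
  comp_idr : forall X Y (f : hom X Y), comp f (idm X) = f;
  compA : forall W X Y Z (h : hom Y Z) (g : hom X Y) (f : hom W X),
    comp h (comp g f) = comp (comp h g) f
}.

#[short(type="category")]
HB.structure Definition Category := { C of isCategory C }.

Arguments idm {s} X.
Arguments comp {s X Y Z} _ _.

Notation "X ~> Y" := (hom X Y) (at level 75, no associativity) : cat_scope.
Notation "'\id_' X" := (idm X)
  (at level 8, X at level 2, format "'\id_' X") : cat_scope.
Notation "g \o f" := (comp g f) : cat_scope.

(* Not assumed strict: the associator [tassoc] and the unitors [tlunit],      *)
(* [trunit] are explicit isomorphisms, with inverses [tassocV], [tlunitV],    *)
(* [trunitV].                                                                 *)
HB.mixin Record isMonoidal C of Category C := {
  tunit : C;
  tens : C -> C -> C;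
  tensm : forall {X X' Y Y' : C},
    (X ~> X') -> (Y ~> Y') -> (tens X Y ~> tens X' Y');
  tassoc : forall X Y Z : C, tens (tens X Y) Z ~> tens X (tens Y Z);
  tassocV : forall X Y Z : C, tens X (tens Y Z) ~> tens (tens X Y) Z;
  tlunit : forall X : C, tens tunit X ~> X;
  tlunitV : forall X : C, X ~> tens tunit X;
  trunit : forall X : C, tens X tunit ~> X;
  trunitV : forall X : C, X ~> tens X tunit;
  tensm_id : forall X Y : C, tensm \id_X \id_Y = \id_(tens X Y);
  tensm_comp : forall (X X' X'' Y Y' Y'' : C)
      (f' : X' ~> X'') (f : X ~> X') (g' : Y' ~> Y'') (g : Y ~> Y'),
    tensm (f' \o f) (g' \o g) = tensm f' g' \o tensm f g;
  tassocK : forall X Y Z : C, tassocV X Y Z \o tassoc X Y Z = \id__;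
  tassocVK : forall X Y Z : C, tassoc X Y Z \o tassocV X Y Z = \id__;
  tlunitK : forall X : C, tlunitV X \o tlunit X = \id__;
  tlunitVK : forall X : C, tlunit X \o tlunitV X = \id__;
  trunitK : forall X : C, trunitV X \o trunit X = \id__;
  trunitVK : forall X : C, trunit X \o trunitV X = \id__;
  tassoc_nat : forall (X X' Y Y' Z Z' : C)
      (f : X ~> X') (g : Y ~> Y') (h : Z ~> Z'),
    tassoc X' Y' Z' \o tensm (tensm f g) h
      = tensm f (tensm g h) \o tassoc X Y Z;
  tlunit_nat : forall (X Y : C) (f : X ~> Y),
    tlunit Y \o tensm \id_tunit f = f \o tlunit X;
  trunit_nat : forall (X Y : C) (f : X ~> Y),
    trunit Y \o tensm f \id_tunit = f \o trunit X;
  triangle : forall X Y : C,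
    tensm \id_X (tlunit Y) \o tassoc X tunit Y = tensm (trunit X) \id_Y;
  pentagon : forall W X Y Z : C,
    tensm \id_W (tassoc X Y Z)
        \o tassoc W (tens X Y) Z \o tensm (tassoc W X Y) \id_Z
      = tassoc W X (tens Y Z) \o tassoc (tens W X) Y Z
}.

#[short(type="monoidalCategory")]
HB.structure Definition MonoidalCategory := { C of Category C & isMonoidal C }.

Arguments tunit {s}.
Arguments tens {s} X Y.
Arguments tensm {s X X' Y Y'} _ _.
Arguments tassoc {s} X Y Z.
Arguments tassocV {s} X Y Z.
Arguments tlunit {s} X.
Arguments tlunitV {s} X.
Arguments trunit {s} X.
Arguments trunitV {s} X.

Notation "X \ox Y" := (tens X Y) (at level 40, left associativity) : cat_scope.
Notation "f \ot g" := (tensm f g) (at level 40, left associativity) : cat_scope.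

HB.mixin Record isSymmetric C of MonoidalCategory C := {
  swap : forall X Y : C, X \ox Y ~> Y \ox X;
  swap_nat : forall (X X' Y Y' : C) (f : X ~> X') (g : Y ~> Y'),
    swap X' Y' \o (f \ot g) = (g \ot f) \o swap X Y;
  swapK : forall X Y : C, swap Y X \o swap X Y = \id__;
  hexagon : forall X Y Z : C,
    tassoc Y Z X \o swap X (Y \ox Z) \o tassoc X Y Z
      = (\id_Y \ot swap X Z) \o tassoc Y X Z \o (swap X Y \ot \id_Z)
}.

#[short(type="symMonoidalCategory")]
HB.structure Definition SymMonoidalCategory :=
  { C of MonoidalCategory C & isSymmetric C }.

Arguments swap {s} X Y.

(* [id (x) swap (x) id] with its bracketing made explicit.                    *)
Definition mid_swap (C : symMonoidalCategory) (X Y : C) :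
    (X \ox X) \ox (Y \ox Y) ~> (X \ox Y) \ox (X \ox Y) :=
  tassocV X Y (X \ox Y)
    \o (\id_X \ot (tassoc Y X Y \o (swap X Y \ot \id_Y) \o tassocV X Y Y))
    \o tassoc X X (Y \ox Y).

HB.mixin Record isMarkov C of SymMonoidalCategory C := {
  del : forall X : C, X ~> tunit;
  del_unique : forall (X : C) (f : X ~> tunit), f = del X;
  copy : forall X : C, X ~> X \ox X;
  copy_assoc : forall X : C,
    tassoc X X X \o (copy X \ot \id_X) \o copy X
      = (\id_X \ot copy X) \o copy X;
  copy_counitl : forall X : C,
    tlunit X \o (del X \ot \id_X) \o copy X = \id_X;
  copy_counitr : forall X : C,
    trunit X \o (\id_X \ot del X) \o copy X = \id_X;
  copy_comm : forall X : C, swap X X \o copy X = copy X;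
  copy_tens : forall X Y : C,
    copy (X \ox Y) = mid_swap X Y \o (copy X \ot copy Y)
}.

#[short(type="markovCategory")]
HB.structure Definition MarkovCategory :=
  { C of SymMonoidalCategory C & isMarkov C }.

Arguments del {s} X.
Arguments copy {s} X.

Definition deterministic (C : markovCategory) (X Y : C) (f : X ~> Y) : Prop :=
  copy Y \o f = (f \ot f) \o copy X.

Definition as_eq (C : markovCategory) (A X Y : C) (h : A ~> X)
    (f g : X ~> Y) : Prop :=
  (\id_X \ot f) \o copy X \o h = (\id_X \ot g) \o copy X \o h.

(* Conditionals with respect to the first, resp. the second, tensor factor of *)
(* the codomain.                                                              *)
Definition conditionall (C : markovCategory) (A X Y : C)
    (f : A ~> X \ox Y) (c : X \ox A ~> Y) : Prop :=
  f = (\id_X \ot c) \o tassoc X X A \o (copy X \ot \id_A)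
        \o ((trunit X \o (\id_X \ot del Y) \o f) \ot \id_A) \o copy A.

Definition conditionalr (C : markovCategory) (A X Y : C)
    (f : A ~> X \ox Y) (c : Y \ox A ~> X) : Prop :=
  conditionall (swap X Y \o f) c.

Definition has_conditionals (C : markovCategory) : Prop :=
  forall (A X Y : C) (f : A ~> X \ox Y), exists c, conditionall f c.

(* A choice of a distribution object for every object: [sharp] is the inverse *)
(* of the map [samp X \o -] from deterministic morphisms [A ~> distr X] to    *)
(* morphisms [A ~> X].                                                        *)
HB.mixin Record isRepresentable C of MarkovCategory C := {
  distr : C -> C;
  samp : forall X : C, distr X ~> X;
  sharp : forall {A X : C}, (A ~> X) -> (A ~> distr X);
  sharp_det : forall (A X : C) (f : A ~> X), deterministic (sharp f);
  sharpK : forall (A X : C) (f : A ~> X), samp X \o sharp f = f;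
  sampK : forall (A X : C) (h : A ~> distr X),
    deterministic h -> sharp (samp X \o h) = h
}.

#[short(type="reprMarkovCategory")]
HB.structure Definition ReprMarkovCategory :=
  { C of MarkovCategory C & isRepresentable C }.

Arguments distr {s} X.
Arguments samp {s} X.
Arguments sharp {s A X} _.

Definition distrm (C : reprMarkovCategory) (X Y : C) (f : X ~> Y) :
    distr X ~> distr Y :=
  sharp (f \o samp X).

Definition as_compatible (C : reprMarkovCategory) : Prop :=
  forall (B A X : C) (p : B ~> A) (f g : A ~> X),
    as_eq p (sharp f) (sharp g) <-> as_eq p f g.

Definition samp_joint (C : reprMarkovCategory) (T X : C) (f : T ~> X) :
    distr T ~> T \ox X :=
  (\id_T \ot f) \o copy T \o samp T.

(* The standard measure of [f] parametrized by the prior, computed from a     *)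
(* conditional [c] of [samp_joint f] with respect to [X]; it does not depend  *)
(* on the choice of [c].                                                      *)
Definition prsamp_measure (C : reprMarkovCategory) (T X : C) (f : T ~> X)
    (c : X \ox distr T ~> T) : distr T ~> distr T :=
  sharp c \o ((f \o samp T) \ot \id_(distr T)) \o copy (distr T).

Definition bayes_more_informative (C : reprMarkovCategory) (T X Y : C)
    (f : T ~> X) (g : T ~> Y) : Prop :=
  exists c : X \ox distr T ~> Y,
    (\id_T \ot c) \o (\id_T \ot (f \ot \id_(distr T)))
      \o tassoc T T (distr T) \o (copy T \ot \id_(distr T))
      \o (samp T \ot \id_(distr T)) \o copy (distr T)
    = (\id_T \ot g) \o copy T \o samp T.

(* Dilations with respect to the free algebra [distrm (samp T)].              *)
Definition dilation (C : reprMarkovCategory) (T B : C) (q : B ~> distr T)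
    (t : B \ox distr T ~> distr T) : Prop :=
  (\id_(distr T) \ot (distrm (samp T) \o sharp t))
    \o tassoc (distr T) B (distr T)
    \o (swap B (distr T) \ot \id_(distr T))
    \o tassocV B (distr T) (distr T)
    \o (\id_B \ot copy (distr T)) \o (\id_B \ot q) \o copy B
  = copy (distr T) \o q.

(* Main.v *)
(* Deterministic morphisms form a cartesian subcategory, so every structural   *)
(* map is a pairing of projections, and pairings commute with deterministic   *)
(* precomposition.  Write W for the prior object and let all variables below  *)
(* depend on the prior m : W.                                                 *)
(* (1 => 2) Given c, the Bayesian condition says that drawing x ~ f, then     *)
(* y ~ c(x, m) and theta from the posterior of x gives the same joint law of  *)
(* (y, theta) as drawing theta from the posterior of y ~ g.  Let t be the     *)
(* conditional, given the posterior of y, of the joint law of the posteriors  *)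
(* of y and of x.  Then t sends the standard measure of g to that of f, and   *)
(* sampling theta from t agrees almost surely with sampling it from its       *)
(* argument; by as-compatibility the barycentre of t is the identity almost   *)
(* surely.                                                                    *)
(* (2 => 1) Draw y ~ g, let t act on the posterior of y, and let l be the     *)
(* conditional of y given the resulting measure, which is distributed as the  *)
(* posterior of x ~ f.  Take c(x, m) := l(posterior of x, m).                 *)

From Pilot Require Import Defs.
From HB Require Import structures.
From mathcomp Require Import ssreflect ssrfun.
(* Imported again so that [compA] does not refer to [ssrfun]. *)
Import Pilot.Defs.
Local Open Scope cat_scope.
Set Implicit Arguments.
Unset Strict Implicit.
Unset Printing Implicit Defensive.

Arguments compA {s W X Y Z} h g f.
Arguments comp_idl {s X Y} f.
Arguments comp_idr {s X Y} f.
Arguments sharpK {s A X} f.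
Arguments sampK {s A X} h _.

(** The posterior of x carries all that x says about theta. A garbling c of x into y thus couples
    the two posteriors, and theta, drawn from either posterior, has the same joint law with the
    posterior of y: this is the dilation ([bayes_dilation]). Conversely, a dilation couples y to a
    measure distributed as the posterior of x, and conditioning y on that measure gives c
    ([dilation_bayes]). All laws are written [pair u v \o pair h \id_W]: draw from [h], then run [u]
    and [v] independently on the result and the prior. [conditionallE], [bayes_more_informativeE]
    and [dilationE] provide this form. *)

(** * Coherence in symmetric monoidal categories *)

Lemma tensm_comp_idl (C : monoidalCategory) (X Y Y' Y'' : C)
    (g' : Y' ~> Y'') (g : Y ~> Y') :
  \id_X \ot (g' \o g) = (\id_X \ot g') \o (\id_X \ot g).
Proof. by rewrite -tensm_comp comp_idl. Qed.

Lemma tensm_comp_idr (C : monoidalCategory) (X X' X'' Y : C)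
    (f' : X' ~> X'') (f : X ~> X') :
  (f' \o f) \ot \id_Y = (f' \ot \id_Y) \o (f \ot \id_Y).
Proof. by rewrite -tensm_comp comp_idl. Qed.

Lemma tensm_id_inj (C : monoidalCategory) (X Y : C) (f g : X ~> Y) :
  \id_tunit \ot f = \id_tunit \ot g -> f = g.
Proof.
move=> e; rewrite -[f]comp_idr -[g]comp_idr -(tlunitVK X) !compA.
by rewrite -!tlunit_nat e.
Qed.

Lemma tensm_idr_inj (C : monoidalCategory) (X Y : C) (f g : X ~> Y) :
  f \ot \id_tunit = g \ot \id_tunit -> f = g.
Proof.
move=> e; rewrite -[f]comp_idr -[g]comp_idr -(trunitVK X) !compA.
by rewrite -!trunit_nat e.
Qed.

Lemma tassoc_epi (C : monoidalCategory) (X Y Z V : C)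
    (f g : X \ox (Y \ox Z) ~> V) :
  f \o tassoc X Y Z = g \o tassoc X Y Z -> f = g.
Proof.
move=> e; rewrite -[f]comp_idr -[g]comp_idr -(tassocVK X Y Z) !compA.
by rewrite e.
Qed.

Lemma tassocV_nat (C : monoidalCategory) (X X' Y Y' Z Z' : C)
    (f : X ~> X') (g : Y ~> Y') (h : Z ~> Z') :
  tassocV X' Y' Z' \o (f \ot (g \ot h)) = ((f \ot g) \ot h) \o tassocV X Y Z.
Proof.
apply: tassoc_epi.
by rewrite -!compA tassocK comp_idr -tassoc_nat compA tassocK comp_idl.
Qed.

Lemma triangleV (C : monoidalCategory) (X Y : C) :
  (trunit X \ot \id_Y) \o tassocV X tunit Y = \id_X \ot tlunit Y.
Proof. by rewrite -triangle -compA tassocVK comp_idr. Qed.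

(** Kelly's argument: tensoring with the unit is faithful, and after it the pentagon and two
    triangles give the identity up to an invertible associator. *)
Lemma tlunit_tassoc (C : monoidalCategory) (X Y : C) :
  tlunit (X \ox Y) \o tassoc tunit X Y = tlunit X \ot \id_Y.
Proof.
apply: tensm_id_inj; apply: tassoc_epi.
have e (u v : tens (tens tunit (tens tunit X)) Y ~> tens tunit (tens X Y)) :
    u \o (tassoc tunit tunit X \ot \id_Y)
      = v \o (tassoc tunit tunit X \ot \id_Y) -> u = v.
  move=> h; rewrite -[u]comp_idr -[v]comp_idr -tensm_id.
  by rewrite -(tassocVK tunit tunit X) tensm_comp_idr !compA h.
apply: e.
rewrite tensm_comp_idl -!compA.
rewrite [(\id_tunit \ot tassoc _ _ _) \o _]compA pentagon [LHS]compA triangle.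
rewrite -[\id_(X \ox Y)]tensm_id.
by rewrite -tassoc_nat -triangle tensm_comp_idr compA tassoc_nat -compA.
Qed.

Lemma trunit_tassoc (C : monoidalCategory) (X Y : C) :
  (\id_X \ot trunit Y) \o tassoc X Y tunit = trunit (X \ox Y).
Proof.
apply: tensm_idr_inj; rewrite tensm_comp_idr.
have e (u v : tens (tens (tens X Y) tunit) tunit ~> tens X Y \ox tunit) :
    tassoc _ _ _ \o u = tassoc _ _ _ \o v -> u = v.
  by move=> h; rewrite -[u]comp_idl -[v]comp_idl -tassocK -!compA h.
apply: e; rewrite [LHS]compA tassoc_nat -[trunit Y \ot _]triangle.
rewrite -[trunit (X \ox Y) \ot _]triangle tensm_comp_idl -!compA.
rewrite [(\id_X \ot tassoc _ _ _) \o _]compA pentagon.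
by rewrite -[\id_(X \ox Y)]tensm_id !compA tassoc_nat.
Qed.

Lemma tlunit_swap (C : symMonoidalCategory) (X : C) :
  tlunit X \o swap X tunit = trunit X.
Proof.
apply: tensm_idr_inj.
have e (u v : X \ox tunit \ox tunit ~> X \ox tunit) :
    swap _ _ \o u = swap _ _ \o v -> u = v.
  by move=> h; rewrite -[u]comp_idl -[v]comp_idl -(swapK X tunit) -!compA h.
apply: e; rewrite tensm_comp_idr -tlunit_tassoc.
rewrite !compA -tlunit_nat -!compA [(\id_tunit \ot _) \o _]compA.
rewrite -hexagon !compA tlunit_tassoc -swap_nat -!compA.
by rewrite triangle.
Qed.

Lemma trunit_swap (C : symMonoidalCategory) (X : C) :
  trunit X \o swap tunit X = tlunit X.
Proof. by rewrite -tlunit_swap -compA swapK comp_idr. Qed.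

(* [interchange], [proj1], [proj2], [pair] and [swapr] are locked because the   *)
(* unifier would otherwise unfold them when rewriting with [compA].           *)
HB.lock Definition interchange (C : symMonoidalCategory) (X X' Y Y' : C) :
    (X \ox X') \ox (Y \ox Y') ~> (X \ox Y) \ox (X' \ox Y') :=
  tassocV X Y (X' \ox Y')
    \o (\id_X \ot (tassoc Y X' Y' \o (swap X' Y \ot \id_Y') \o tassocV X' Y Y'))
    \o tassoc X X' (Y \ox Y').

Lemma interchange_nat (C : symMonoidalCategory) (X X' Y Y' Z Z' T T' : C)
    (f : X ~> Z) (f' : X' ~> Z') (g : Y ~> T) (g' : Y' ~> T') :
  interchange Z Z' T T' \o ((f \ot f') \ot (g \ot g'))
    = ((f \ot g) \ot (f' \ot g')) \o interchange X X' Y Y'.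
Proof.
rewrite interchange.unlock -!compA tassoc_nat [in RHS]compA -tassocV_nat -!compA.
congr (_ \o _); rewrite !compA -!tensm_comp comp_idl comp_idr -!compA.
congr (_ \ot _ \o _).
rewrite tassocV_nat [in RHS]compA -tassoc_nat -!compA; congr (_ \o _).
by rewrite !compA -!tensm_comp comp_idl comp_idr swap_nat.
Qed.

(** * Pairings, projections and deterministic morphisms *)

Lemma del_eq (C : markovCategory) (X : C) (f g : X ~> tunit) : f = g.
Proof. by rewrite (del_unique _ f) (del_unique _ g). Qed.

Lemma del2_eq (C : markovCategory) (X : C) (f g : X ~> tunit \ox tunit) : f = g.
Proof.
rewrite -[f]comp_idl -[g]comp_idl -(tlunitK tunit) -!compA.
by congr (_ \o _); apply: del_eq.
Qed.

HB.lock Definition proj1 (C : markovCategory) (X Y : C) : X \ox Y ~> X :=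
  trunit X \o (\id_X \ot del Y).

HB.lock Definition proj2 (C : markovCategory) (X Y : C) : X \ox Y ~> Y :=
  tlunit Y \o (del X \ot \id_Y).

HB.lock Definition pair (C : markovCategory) (A X Y : C) (f : A ~> X) (g : A ~> Y) :
  A ~> X \ox Y := (f \ot g) \o copy A.

Lemma pair_tensm (C : markovCategory) (A X Y : C) (f : A ~> X) (g : A ~> Y) :
  pair f g = (f \ot g) \o copy A.
Proof. by rewrite pair.unlock. Qed.

Lemma tensm_pair (C : markovCategory) (A X X' Y Y' : C) (h : X ~> X')
    (k : Y ~> Y') (f : A ~> X) (g : A ~> Y) :
  (h \ot k) \o pair f g = pair (h \o f) (k \o g).
Proof. by rewrite pair.unlock compA -tensm_comp. Qed.

Lemma proj1_pair (C : markovCategory) (A X Y : C) (f : A ~> X) (g : A ~> Y) :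
  proj1 X Y \o pair f g = f.
Proof.
rewrite proj1.unlock -compA tensm_pair comp_idl (del_unique _ (_ \o _)).
rewrite pair.unlock -[f in f \ot _]comp_idr -[del A]comp_idl tensm_comp -!compA.
rewrite [trunit X \o _]compA trunit_nat -!compA [X in f \o X]compA.
by rewrite copy_counitr comp_idr.
Qed.

Lemma swap_pair (C : markovCategory) (A X Y : C) (f : A ~> X) (g : A ~> Y) :
  swap X Y \o pair f g = pair g f.
Proof. by rewrite pair.unlock compA swap_nat -compA copy_comm. Qed.

Lemma proj1_swap (C : markovCategory) (X Y : C) :
  proj1 Y X \o swap X Y = proj2 X Y.
Proof. by rewrite proj1.unlock proj2.unlock -compA -swap_nat compA trunit_swap. Qed.

Lemma proj2_pair (C : markovCategory) (A X Y : C) (f : A ~> X) (g : A ~> Y) :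
  proj2 X Y \o pair f g = g.
Proof. by rewrite -proj1_swap -compA swap_pair proj1_pair. Qed.

Lemma tassoc_pair (C : markovCategory) (A X Y Z : C)
    (f : A ~> X) (g : A ~> Y) (h : A ~> Z) :
  tassoc X Y Z \o pair (pair f g) h = pair f (pair g h).
Proof.
rewrite pair.unlock -[h in LHS]comp_idr tensm_comp !compA tassoc_nat.
rewrite -[_ \o tassoc _ _ _ \o _]compA -[LHS]compA [X in _ \o X]copy_assoc.
by rewrite compA -tensm_comp comp_idr.
Qed.

Lemma tassocV_pair (C : markovCategory) (A X Y Z : C)
    (f : A ~> X) (g : A ~> Y) (h : A ~> Z) :
  tassocV X Y Z \o pair f (pair g h) = pair (pair f g) h.
Proof. by rewrite -tassoc_pair compA tassocK comp_idl. Qed.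

Lemma interchange_pair (C : markovCategory) (A X X' Y Y' : C)
    (f : A ~> X) (f' : A ~> X') (g : A ~> Y) (g' : A ~> Y') :
  interchange X X' Y Y' \o pair (pair f f') (pair g g')
    = pair (pair f g) (pair f' g').
Proof.
rewrite interchange.unlock -!compA tassoc_pair tensm_pair comp_idl -!compA.
by rewrite tassocV_pair tensm_pair swap_pair comp_idl tassoc_pair tassocV_pair.
Qed.

Lemma copy_interchange (C : markovCategory) (X Y : C) :
  copy (X \ox Y) = interchange X X Y Y \o (copy X \ot copy Y).
Proof. by rewrite interchange.unlock copy_tens. Qed.

Lemma interchange_unit (C : markovCategory) (X Y : C) :
  interchange X tunit tunit Y = \id_(X \ox tunit \ox (tunit \ox Y)).
Proof.
rewrite interchange.unlock (del2_eq (swap tunit tunit) \id__) tensm_id comp_idr.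
by rewrite tassocVK tensm_id comp_idr tassocK.
Qed.

Lemma trunit_interchange (C : symMonoidalCategory) (X Y : C) :
  (trunit X \ot trunit Y) \o interchange X Y tunit tunit
    = trunit (X \ox Y) \o (\id_(X \ox Y) \ot tlunit tunit).
Proof.
have e : (trunit X \ot trunit Y) \o tassocV X tunit (Y \ox tunit)
    = \id_X \ot (trunit Y \o tlunit (Y \ox tunit)).
  rewrite -[trunit X]comp_idl -[trunit Y]comp_idr tensm_comp -compA triangleV.
  by rewrite -tensm_comp comp_idl comp_idr.
rewrite interchange.unlock !compA e -tensm_comp comp_idl !compA.
rewrite -[trunit Y \o _ \o _]compA tlunit_tassoc.
rewrite -[trunit Y \o _ \o _]compA -tensm_comp tlunit_swap comp_idl.
rewrite -compA triangleV tensm_comp_idl -compA -tassoc_nat compA trunit_tassoc.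
by rewrite tensm_id.
Qed.

Lemma tlunit_interchange (C : symMonoidalCategory) (X Y : C) :
  (tlunit X \ot tlunit Y) \o interchange tunit tunit X Y
    = tlunit (X \ox Y) \o (tlunit tunit \ot \id_(X \ox Y)).
Proof.
have e : (tlunit X \ot tlunit Y) \o tassocV tunit X (tunit \ox Y)
    = tlunit (X \ox Y) \o (\id_tunit \ot (\id_X \ot tlunit Y)).
  rewrite tlunit_nat; apply: tassoc_epi.
  rewrite -!compA tassocK tlunit_tassoc comp_idr.
  by rewrite -tensm_comp comp_idl comp_idr.
rewrite interchange.unlock !compA e.
rewrite -[tlunit _ \o _ \o _]compA -tensm_comp comp_idl !compA triangle.
rewrite -tensm_comp trunit_swap comp_idl.
rewrite -[tlunit X \ot _]tlunit_tassoc -[_ \o tassocV _ _ _]compA tassocVK.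
by rewrite comp_idr tlunit_nat -compA tlunit_tassoc.
Qed.

Lemma pair_proj (C : markovCategory) (X Y : C) :
  pair (proj1 X Y) (proj2 X Y) = \id_(X \ox Y).
Proof.
rewrite pair.unlock copy_interchange proj1.unlock proj2.unlock tensm_comp -!compA.
rewrite [(_ \ot (del X \ot _)) \o _]compA -interchange_nat interchange_unit.
rewrite comp_idl -!tensm_comp.
by rewrite !compA copy_counitl copy_counitr tensm_id.
Qed.

Lemma deterministic_id (C : markovCategory) (X : C) : deterministic \id_X.
Proof. by rewrite /deterministic tensm_id comp_idl comp_idr. Qed.

Lemma deterministic_comp (C : markovCategory) (X Y Z : C)
    (g : Y ~> Z) (f : X ~> Y) :
  deterministic g -> deterministic f -> deterministic (g \o f).
Proof.
by rewrite /deterministic => dg df; rewrite compA dg -compA df tensm_comp !compA.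
Qed.

Lemma deterministic_proj1 (C : markovCategory) (X Y : C) :
  deterministic (proj1 X Y).
Proof.
rewrite /deterministic copy_interchange proj1.unlock tensm_comp -!compA.
rewrite [(_ \ot (_ \ot _)) \o _]compA -interchange_nat -compA.
rewrite -tensm_comp tensm_id comp_idl.
rewrite [RHS]compA trunit_interchange -compA -tensm_comp comp_idl.
rewrite (del_eq (tlunit tunit \o _) (del Y)) [LHS]compA -trunit_nat -compA.
by rewrite -tensm_comp comp_idl comp_idr.
Qed.

Lemma deterministic_proj2 (C : markovCategory) (X Y : C) :
  deterministic (proj2 X Y).
Proof.
rewrite /deterministic copy_interchange proj2.unlock tensm_comp -!compA.
rewrite [(_ \ot (_ \ot _)) \o _]compA -interchange_nat -compA.
rewrite -tensm_comp tensm_id comp_idl.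
rewrite [RHS]compA tlunit_interchange -compA -tensm_comp comp_idl.
rewrite (del_eq (tlunit tunit \o _) (del X)) [LHS]compA -tlunit_nat -compA.
by rewrite -tensm_comp comp_idl comp_idr.
Qed.

Lemma copy_pair (C : markovCategory) (X : C) : copy X = pair \id_X \id_X.
Proof. by rewrite pair.unlock tensm_id comp_idl. Qed.

Lemma deterministic_pair (C : markovCategory) (A X Y : C)
    (f : A ~> X) (g : A ~> Y) :
  deterministic f -> deterministic g -> deterministic (pair f g).
Proof.
rewrite /deterministic => df dg.
rewrite copy_interchange -compA tensm_pair df dg -!tensm_pair compA.
rewrite interchange_nat -compA copy_pair interchange_pair -copy_pair.
by rewrite pair.unlock tensm_comp -compA.
Qed.

Lemma pair_comp (C : markovCategory) (A B X Y : C) (d : B ~> A)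
    (f : A ~> X) (g : A ~> Y) :
  deterministic d -> pair f g \o d = pair (f \o d) (g \o d).
Proof.
by rewrite /deterministic pair.unlock => dd; rewrite -compA dd compA -tensm_comp.
Qed.

Ltac det := repeat first
  [ apply: deterministic_id | apply: deterministic_proj1
  | apply: deterministic_proj2 | apply: sharp_det
  | apply: deterministic_pair | apply: deterministic_comp | assumption ].

#[local] Hint Extern 0 (deterministic _) => solve [det] : core.

Ltac cart :=
  repeat first
   [ rewrite comp_idl | rewrite comp_idr | rewrite -compA
   | rewrite proj1_pair | rewrite proj2_pair
   | rewrite tensm_pair | rewrite swap_pair | rewrite tassoc_pair
   | rewrite [proj1 _ _ \o (pair _ _ \o _)]compA proj1_pair
   | rewrite [proj2 _ _ \o (pair _ _ \o _)]compA proj2_pair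
   | match goal with
     | |- context [comp (pair ?f ?g) ?d] =>
         rewrite (@pair_comp _ _ _ _ _ d f g); last by auto 20
     | |- context [comp (pair ?f ?g) (comp ?d ?e)] =>
         rewrite (compA (pair f g) d e) (@pair_comp _ _ _ _ _ d f g);
           last by auto 20
     end ].

Lemma pair_comp_proj1 (C : markovCategory) (A B X Y Z : C) (q : B ~> A)
    (r : B ~> Z) (f : A ~> X) (g : A ~> Y) :
  pair (f \o proj1 A Z) (g \o proj1 A Z) \o pair q r = pair f g \o q.
Proof. by rewrite -pair_comp // -compA proj1_pair. Qed.

Lemma pair_eta (C : markovCategory) (A X Y : C) (d : A ~> X \ox Y) :
  deterministic d -> pair (proj1 X Y \o d) (proj2 X Y \o d) = d.
Proof. by move=> dd; rewrite -pair_comp // pair_proj comp_idl. Qed.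

Lemma tensmE (C : markovCategory) (X X' Y Y' : C) (f : X ~> X') (g : Y ~> Y') :
  f \ot g = pair (f \o proj1 X Y) (g \o proj2 X Y).
Proof. by rewrite -tensm_pair pair_proj comp_idr. Qed.

Lemma swapE (C : markovCategory) (X Y : C) :
  swap X Y = pair (proj2 X Y) (proj1 X Y).
Proof. by rewrite -(swap_pair (proj1 _ _)) pair_proj comp_idr. Qed.

Lemma tassocE (C : markovCategory) (X Y Z : C) :
  tassoc X Y Z = pair (proj1 X Y \o proj1 (X \ox Y) Z)
                   (pair (proj2 X Y \o proj1 (X \ox Y) Z) (proj2 (X \ox Y) Z)).
Proof. by rewrite -tassoc_pair pair_eta // pair_proj comp_idr. Qed.

Lemma tassocVE (C : markovCategory) (X Y Z : C) :
  tassocV X Y Z = pair (pair (proj1 X (Y \ox Z)) (proj1 Y Z \o proj2 X (Y \ox Z)))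
                    (proj2 Y Z \o proj2 X (Y \ox Z)).
Proof. by rewrite -tassocV_pair pair_eta // pair_proj comp_idr. Qed.

HB.lock Definition swapr (C : markovCategory) (X Y Z : C) :
    X \ox Y \ox Z ~> X \ox Z \ox Y :=
  pair (pair (proj1 X Y \o proj1 _ Z) (proj2 _ _)) (proj2 X Y \o proj1 _ Z).

(** The components need not be deterministic, so [pair_comp] does not apply to them; the permutation
    is first built from associators and a swap, then compared with [swapr] on projections. *)
Lemma swapr_pair (C : markovCategory) (A X Y Z : C)
    (f : A ~> X) (g : A ~> Y) (h : A ~> Z) :
  swapr X Y Z \o pair (pair f g) h = pair (pair f h) g.
Proof.
rewrite -[RHS]tassocV_pair -(swap_pair g h) -[f]comp_idl -tensm_pair comp_idl.
rewrite -tassoc_pair !compA; congr (_ \o _).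
rewrite swapr.unlock swapE tensmE tassocE tassocVE.
by cart.
Qed.

(* A kernel [k] reading the parameter [A] may be run while keeping a copy of  *)
(* that parameter, so an identity of joint laws survives adjoining it.        *)
Lemma pair_keep (C : markovCategory) (A Z V : C) (h : A ~> Z) (k : Z \ox A ~> V) :
  pair k (proj2 Z A) \o pair h \id_A = pair (k \o pair h \id_A) \id_A.
Proof.
have -> : pair k (proj2 Z A)
    = (k \ot \id_A) \o tassocV Z A A \o (\id_Z \ot copy A).
  by rewrite tassocVE !tensmE copy_pair; cart; rewrite pair_proj comp_idr.
rewrite -!compA tensm_pair comp_idl comp_idr copy_pair tassocV_pair tensm_pair.
by rewrite comp_idl.
Qed.

(** * Conditionals, the Bayesian order and dilations as pairings *)

Lemma conditionallE (C : markovCategory) (A X Y : C)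
    (f : A ~> X \ox Y) (c : X \ox A ~> Y) :
  conditionall f c <->
  f = pair (proj1 X A) c \o pair (proj1 X Y \o f) \id_A.
Proof.
rewrite /conditionall.
have -> : \id_X \ot c \o tassoc X X A \o copy X \ot \id_A = pair (proj1 X A) c.
  by rewrite copy_pair !tensmE tassocE; cart; rewrite pair_proj comp_idr.
by rewrite -compA proj1.unlock pair.unlock.
Qed.

Lemma samp_joint_conditional (C : reprMarkovCategory) (T X : C) (f : T ~> X)
    (c : X \ox distr T ~> T) :
  conditionalr (samp_joint f) c ->
  pair f \id_T \o samp T
    = pair (proj1 X (distr T)) c \o pair (f \o samp T) \id_(distr T).
Proof.
have e : swap T X \o samp_joint f = pair f \id_T \o samp T.
  by rewrite /samp_joint copy_pair tensm_pair !comp_idl comp_idr compA swap_pair.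
by rewrite /conditionalr e => /conditionallE {1}->; rewrite compA proj1_pair.
Qed.

(** Bayesian inversion: drawing x and then theta from [cf] has the same law as drawing theta and
    then x from [f]; [pair_keep] retains the prior that [c] reads. *)
Lemma bayes_more_informativeE (C : reprMarkovCategory) (T X Y : C)
    (f : T ~> X) (g : T ~> Y) (cf : X \ox distr T ~> T) :
  conditionalr (samp_joint f) cf ->
  bayes_more_informative f g <->
  exists c : X \ox distr T ~> Y,
    pair c cf \o pair (f \o samp T) \id_(distr T) = pair g \id_T \o samp T.
Proof.
move=> /samp_joint_conditional hcf.
have hc (c : X \ox distr T ~> Y) :
    pair c cf \o pair (f \o samp T) \id_(distr T)
    = (c \ot \id_T) \o swapr _ _ _ \o (pair f \id_T \ot \id_(distr T))
      \o pair (samp T) \id_(distr T).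
  rewrite -compA tensm_pair hcf comp_idl -pair_keep compA -(compA (_ \ot _)).
  by rewrite swapr_pair pair_proj tensm_pair comp_idl comp_idr.
have e (c : X \ox distr T ~> Y) :
    (\id_T \ot c) \o (\id_T \ot (f \ot \id_(distr T)))
      \o tassoc T T (distr T) \o (copy T \ot \id_(distr T))
      \o (samp T \ot \id_(distr T)) \o copy (distr T)
    = swap Y T \o (pair c cf \o pair (f \o samp T) \id_(distr T)).
  rewrite {}hc (pair_tensm (samp T)) !compA; congr (_ \o _ \o _).
  rewrite copy_pair (tensmE (pair _ _) \id__) (tensmE (pair f _)).
  by cart; rewrite !swapr_pair; cart.
have eg : (\id_T \ot g) \o copy T \o samp T
    = swap Y T \o (pair g \id_T \o samp T).
  by rewrite copy_pair tensm_pair !compA swap_pair !comp_idr.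
split=> -[c h]; exists c; last by rewrite e h eg.
by rewrite -[LHS]comp_idl -swapK -compA -e h eg compA swapK comp_idl.
Qed.

Lemma prsamp_measureE (C : reprMarkovCategory) (T X : C) (f : T ~> X)
    (c : X \ox distr T ~> T) :
  prsamp_measure f c = sharp c \o pair (f \o samp T) \id_(distr T).
Proof. by rewrite pair_tensm compA. Qed.

(** Both sides are deterministic and agree after [samp]. *)
Lemma sharp_comp (C : reprMarkovCategory) (A B X : C) (f : A ~> X) (d : B ~> A) :
  deterministic d -> sharp (f \o d) = sharp f \o d.
Proof. by move=> dd; rewrite -[in LHS](sharpK f) -compA sampK; auto. Qed.

(** The barycentre [distrm (samp T) \o sharp t] is [sharp (samp T \o t)]. The swap moves the prior
    to the second factor, where conditionals have it. *)
Lemma dilationE (C : reprMarkovCategory) (T B : C) (q : B ~> distr T)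
    (t : B \ox distr T ~> distr T) :
  dilation q t <->
  pair (proj1 (distr T) B) (sharp (samp T \o (t \o swap _ _))) \o pair q \id_B
    = copy (distr T) \o q.
Proof.
rewrite /dilation.
have -> : distrm (samp T) \o sharp t = sharp (samp T \o t).
  by rewrite /distrm -sharp_comp ?sharpK -?compA ?sharpK; auto.
have -> : \id_(distr T) \ot sharp (samp T \o t) \o tassoc (distr T) B (distr T)
      \o swap B (distr T) \ot \id_(distr T)
      \o tassocV B (distr T) (distr T) \o \id_B \ot copy (distr T)
    = pair (proj1 (distr T) B) (sharp (samp T \o (t \o swap _ _))) \o swap _ _.
  rewrite copy_pair !tensmE tassocE tassocVE !swapE.
  rewrite [samp T \o (_ \o _)]compA (sharp_comp (samp T \o t)); last by auto.
  by cart.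
by rewrite -!compA -pair_tensm swap_pair.
Qed.

(** Used to strengthen an identity retaining only the value of [q] to almost sure equality for
    [pair q \id_A], which retains the parameter too. *)
Lemma pair_proj1_eq (C : markovCategory) (A X Z : C) (q : A ~> X)
    (u v : X \ox A ~> Z) :
  pair (proj1 X A) u \o pair q \id_A = pair (proj1 X A) v \o pair q \id_A ->
  pair \id_(X \ox A) u \o pair q \id_A = pair \id_(X \ox A) v \o pair q \id_A.
Proof.
move=> e; have k w : pair \id_(X \ox A) w \o pair q \id_A
    = swapr _ _ _ \o pair (pair (proj1 X A) w \o pair q \id_A) \id_A.
  by rewrite -pair_keep compA swapr_pair pair_proj.
by rewrite !k e.
Qed.

(** * The two implications *)

Lemma bayes_dilation (C : reprMarkovCategory)
    (hcond : has_conditionals C) (hcompat : as_compatible C)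
    (T X Y : C) (f : T ~> X) (g : T ~> Y)
    (cf : X \ox distr T ~> T) (cg : Y \ox distr T ~> T)
    (hcg : conditionalr (samp_joint g) cg) (c : X \ox distr T ~> Y) :
  pair c cf \o pair (f \o samp T) \id_(distr T) = pair g \id_T \o samp T ->
  exists2 t : distr T \ox distr T ~> distr T,
    dilation (prsamp_measure g cg) t &
    t \o (\id_(distr T) \ot prsamp_measure g cg) \o copy (distr T)
      = prsamp_measure f cf.
Proof.
rewrite (samp_joint_conditional hcg) => h.
have hy : c \o pair (f \o samp T) \id_(distr T) = g \o samp T.
  have := congr1 (comp (proj1 Y T)) h.
  by rewrite !compA !proj1_pair.
have e : pair (pair c cf) (proj2 _ _) \o pair (f \o samp T) \id_(distr T)
    = pair (pair (proj1 _ _) cg) (proj2 _ _) \o pair (g \o samp T) \id_(distr T).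
  by rewrite !pair_keep h.
set q := prsamp_measure g cg.
have hq : q = sharp cg \o pair (g \o samp T) \id_(distr T).
  exact: prsamp_measureE.
clearbody q.
(* Joint law of the posteriors of y and of x, with y drawn from x by [c]. *)
pose Q := pair (sharp cg \o pair c (proj2 _ _)) (sharp cf)
            \o pair (f \o samp T) \id_(distr T).
have Q1 : proj1 _ _ \o Q = q.
  by rewrite /Q compA proj1_pair -compA pair_keep hy hq.
have [t /conditionallE] := hcond _ _ _ Q; rewrite Q1 => hQ.
exists (t \o swap _ _); last first.
  rewrite -compA -pair_tensm -compA swap_pair.
  rewrite -(proj2_pair (proj1 _ _) t) -compA -hQ /Q compA proj2_pair.
  by rewrite prsamp_measureE.
apply/dilationE; rewrite -(compA t) swapK comp_idr copy_pair.
(* By [e], theta drawn from the posterior of x may be replaced by theta drawn from that of y. *)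
have F : pair (proj1 _ _) (samp T \o t) \o pair q \id_(distr T)
    = pair (proj1 _ _) (samp T \o proj1 _ _) \o pair q \id_(distr T).
  have -> : pair (proj1 _ _) (samp T \o t) \o pair q \id_(distr T)
     = (\id_(distr T) \ot samp T) \o Q.
    by rewrite hQ compA tensm_pair comp_idl.
  rewrite compA tensm_pair comp_idl sharpK.
  rewrite -[cf]comp_idl -tensm_pair -swapr_pair -!compA e.
  rewrite (compA (swapr _ _ _)) swapr_pair pair_proj compA tensm_pair.
  rewrite comp_idr comp_idl.
  rewrite -[X in _ = pair X _ \o _]comp_idl pair_comp_proj1 hq compA pair_comp //.
  by rewrite comp_idl sharpK.
have /hcompat : as_eq (pair q \id_(distr T)) (samp T \o t) (samp T \o proj1 _ _).
  by rewrite /as_eq copy_pair !tensm_pair !comp_idr; exact: pair_proj1_eq.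
rewrite /as_eq (sampK (proj1 _ _)); last by auto.
rewrite copy_pair !tensm_pair !comp_idr => E.
(* The prior, retained for [hcompat], is discarded again. *)
have := congr1 (comp (proj1 _ _ \ot \id__)) E.
rewrite !compA !tensm_pair !comp_idl !comp_idr => ->.
by rewrite -(pair_comp_proj1 q \id_(distr T)) !comp_idl.
Qed.

Lemma dilation_bayes (C : reprMarkovCategory) (hcond : has_conditionals C)
    (T X Y : C) (f : T ~> X) (g : T ~> Y)
    (cf : X \ox distr T ~> T) (cg : Y \ox distr T ~> T)
    (hcg : conditionalr (samp_joint g) cg)
    (t : distr T \ox distr T ~> distr T) :
  dilation (prsamp_measure g cg) t ->
  t \o (\id_(distr T) \ot prsamp_measure g cg) \o copy (distr T)
      = prsamp_measure f cf ->
  exists c : X \ox distr T ~> Y,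
    pair c cf \o pair (f \o samp T) \id_(distr T) = pair g \id_T \o samp T.
Proof.
rewrite (samp_joint_conditional hcg).
set q := prsamp_measure g cg; set p := prsamp_measure f cf.
have hq : q = sharp cg \o pair (g \o samp T) \id_(distr T).
  exact: prsamp_measureE.
have hp : p = sharp cf \o pair (f \o samp T) \id_(distr T).
  exact: prsamp_measureE.
clearbody q p.
move=> /dilationE hd; rewrite -compA -pair_tensm => ht.
pose t' := t \o swap (distr T) (distr T).
have ht' : t' \o pair q \id_(distr T) = p by rewrite -compA swap_pair.
have F : pair (proj1 _ _) (samp T \o t') \o pair q \id_(distr T)
    = pair (proj1 _ _) (samp T \o proj1 _ _) \o pair q \id_(distr T).
  have := congr1 (comp (\id__ \ot samp T)) hd.
  rewrite copy_pair !compA !tensm_pair !comp_idl sharpK comp_idr => ->.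
  by rewrite -(pair_comp_proj1 q \id_(distr T)) comp_idl.
clearbody t'.
(* [k] recovers y from its posterior and the prior; [l] below recovers it from the dilated
   measure. *)
have [k /conditionallE] :=
  hcond _ _ _ (pair (sharp cg) (proj1 _ _) \o pair (g \o samp T) \id_(distr T)).
rewrite (compA (proj1 _ _)) proj1_pair -hq => hk.
have [l /conditionallE] := hcond _ _ _ (pair t' k \o pair q \id_(distr T)).
rewrite (compA (proj1 _ _)) proj1_pair ht' => hl.
exists (l \o pair (sharp cf) (proj2 _ _)).
have -> : pair (l \o pair (sharp cf) (proj2 _ _)) cf
    = pair l (samp T \o proj1 _ _) \o pair (sharp cf) (proj2 _ _).
  by cart; rewrite sharpK.
rewrite -compA pair_keep -hp.
have sw (U V W : C) (u : U ~> V) (v : U ~> distr T) (w : W ~> U) :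
    pair u (samp T \o v) \o w
      = (swap _ _ \o (samp T \ot \id__)) \o (pair v u \o w).
  by rewrite [RHS]compA -(compA (swap _ _)) tensm_pair swap_pair comp_idl.
rewrite sw -hl -sw.
have -> : pair k (samp T \o t') \o pair q \id_(distr T)
   = (k \ot \id__) \o (pair \id__ (samp T \o t') \o pair q \id_(distr T)).
  by rewrite [RHS]compA tensm_pair comp_idl comp_idr.
(* Theta may be drawn from the posterior of y instead of its dilation, even jointly with y, since
   [k] reads only that posterior and the prior. *)
rewrite (pair_proj1_eq F) compA tensm_pair comp_idl comp_idr.
by rewrite sw -hk -sw sharpK.
Qed.

Theorem corollary5p20 (C : reprMarkovCategory)
    (hcond : has_conditionals C) (hcompat : as_compatible C)
    (T X Y : C) (f : T ~> X) (g : T ~> Y)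
    (cf : X \ox distr T ~> T) (hcf : conditionalr (samp_joint f) cf)
    (cg : Y \ox distr T ~> T) (hcg : conditionalr (samp_joint g) cg) :
  bayes_more_informative f g <->
  exists2 t : distr T \ox distr T ~> distr T,
    dilation (prsamp_measure g cg) t &
    t \o (\id_(distr T) \ot prsamp_measure g cg) \o copy (distr T)
      = prsamp_measure f cf.
Proof.
split=> [/(bayes_more_informativeE g hcf) [c]|[t ht1 ht2]].
  exact: bayes_dilation.
by apply/(bayes_more_informativeE g hcf)/(dilation_bayes hcond hcg ht1).
Qed.
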